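(* Let $(\Omega,\mathcal{F})$ be a measurable space, let $X$ be a finite dimensional Banach space with $B_2$ separable, and let $T:\Omega\times B_2\to E(X,B_1)$ be a random operator. Suppose that, for each $\omega\in\Omega$, $T(\omega,\cdot)$ is lower semicontinuous, condensing, with nonempty values, and that the inverse $(T(\omega,\cdot))^{-1}$ is closed valued, i.e. $\{x\in B_2: y\in T(\omega,x)\}$ is closed for every $y\in X$. Then there exist a measurable mapping $\xi:\Omega\to B_1$ and a mapping $\eta:\Omega\to X$ such that for each $\omega\in\Omega$ $$\eta(\omega)\in T(\omega,\xi(\omega))$$ and $$\|\eta(\omega)-\xi(\omega)\|=d(\eta(\omega),B_1)=d\big(\eta(\omega),\overline{I_{B_1}(\xi(\omega))}\big).$$
   Context: For $R>0$, $B_R=\{x\in X:\|x\|\le R\}$. For $x\in X$, $B(x,r)=\{y\in X:\|y-x\|<r\}$, and $E(X,B_1)=\{B(x,r)\subset X: x\in B_1,\ r\ge 0\}$; so each value $T(\omega,x)$ is a subset of $X$ of the form $B(c,r)$ with $c\in B_1$. For $B_0\subseteq X$, $d(y,B_0)=\inf_{x\in B_0}\|y-x\|$. The inward set of $C\subseteq X$ at $x$ is $I_C(x)=\{x+r(y-x): y\in C,\ r\ge 0\}$; the bar denotes closure. $2^{X}$ is the set of nonempty subsets of $X$; for $F:B_2\to 2^{X}$ and $A\subseteq B_2$, $F(A)=\bigcup_{x\in A}F(x)$. Random operator: for each $x\in B_2$, $T(\cdot,x)$ is (lower) measurable, i.e. $\{\omega\in\Omega: T(\omega,x)\cap V\neq\emptyset\}\in\mathcal{F}$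 for every open $V\subseteq X$. Lower semicontinuous: $F:B_2\to 2^{X}$ is lower semicontinuous if for each $x\in B_2$ and each open $V\subseteq X$ with $F(x)\cap V\neq\emptyset$ there is an open neighborhood $U$ of $x$ in $B_2$ with $F(y)\cap V\neq\emptyset$ for each $y\in U$. Condensing: $\gamma$ is the Kuratowski measure of noncompactness: for bounded $A\subseteq X$, $\gamma(A)=\inf\{e>0: A$ is covered by a finite number of sets of diameter $\le e\}$, and $\gamma(A)=\infty$ if $A$ is unbounded. $F:B_2\to 2^{X}$ is condensing if $\gamma(F(A))<\gamma(A)$ for each $A\subseteq B_2$ with $\gamma(A)>0$. *)

(* Defs.v *)
From HB Require Import structures.
From mathcomp Require Import all_boot all_order all_algebra.
From mathcomp Require Import all_classical all_reals all_analysis.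

Set Implicit Arguments.
Unset Strict Implicit.
Unset Printing Implicit Defensive.

Import Order.TTheory GRing.Theory Num.Theory.
Import numFieldNormedType.Exports.

Local Open Scope classical_set_scope.
Local Open Scope ring_scope.

Definition finite_dimensional (K : fieldType) (V : lmodType K) : Prop :=
  exists (n : nat) (e : 'I_n -> V),
    forall x : V, exists a : 'I_n -> K, x = \sum_(i < n) a i *: e i.

(* Separability of [A] in the subspace topology: the countable dense set is
   taken inside [A]. *)
Definition separable_set (T : topologicalType) (A : set T) : Prop :=
  exists S : set T, [/\ countable S, S `<=` A & A `<=` closure S].

Section NormedSpace.
Context {R : realType} {X : normedModType R}.
Implicit Types (A C D V : set X) (x y : X) (F : X -> set X).

(* Not the library's [closed_ball], which is the closure of an open ball. *)
Definition norm_ball (r : R) : set X := [set x | `|x| <= r].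

(* [E(X, C)]: the open balls with centre in [C]; radius [0] gives [set0]. *)
Definition open_balls_centered_in C : set (set X) :=
  [set B | exists c r, [/\ C c, 0 <= r & B = ball c r]].

(* Used only for nonempty [A], where [inf] is the true infimum. *)
Definition dist y A : R := inf [set `|x - y| | x in A].

Definition inward_set C x : set X :=
  [set z | exists y r, [/\ C y, 0 <= r & z = x + r *: (y - x)]].

Definition finite_cover_of_diam A (e : R) : Prop :=
  exists S : set (set X),
    [/\ finite_set S, A `<=` \bigcup_(s in S) s &
        forall s, S s -> forall x y, s x -> s y -> `|x - y| <= e].

(* Kuratowski measure of noncompactness *)
Definition kuratowski_mnc A : \bar R :=
  if `[< bounded_set A >]
  then (inf [set e | 0 < e /\ finite_cover_of_diam A e])%:E
  else +oo%E.

(* Multifunctions [D -> 2^X] are total maps [F : X -> set X] whose values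
   outside [D] are irrelevant. *)
Definition lsc_on D F : Prop :=
  forall x, D x -> forall V, open V -> F x `&` V !=set0 ->
  exists2 U : set X, open_nbhs x U &
    forall y, D y -> U y -> F y `&` V !=set0.

Definition condensing_on D F : Prop :=
  forall A, A `<=` D -> (0 < kuratowski_mnc A)%E ->
  (kuratowski_mnc (\bigcup_(x in A) F x) < kuratowski_mnc A)%E.

Definition random_operator_on d (Omega : measurableType d) D
    (T : Omega -> X -> set X) : Prop :=
  forall x, D x -> forall V, open V ->
  measurable [set w | T w x `&` V !=set0].

End NormedSpace.

(* [X] with its Borel sigma-algebra *)
Definition borelType (X : ptopologicalType) := g_sigma_algebraType (@open X).

(* Main.v *)
(* A ball-valued lower semicontinuous map F on a finite-dimensional space has
   open fibres {x | y in F x}: by compactness of the unit ball, for x' near x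
   the ball F x' approximates a whole small sphere around y, and a ball that
   does so contains y. When the fibres are also closed they are clopen in the
   connected set B_2, hence T(w, .) is constant on B_2. It then suffices to
   select a point of T(w, 0) in B_1, measurably in w: the first such point of a
   dense sequence is a random fixed point, for which both distances vanish. *)
Require Import Defs.
From HB Require Import structures.
From mathcomp Require Import all_boot all_order all_algebra.
From mathcomp Require Import all_classical all_reals all_analysis.
Import Order.TTheory GRing.Theory Num.Theory.
Import numFieldNormedType.Exports.
Local Open Scope classical_set_scope.
Local Open Scope ring_scope.

(** The coordinate map [f] is continuous, so the images [K N] of the cubes of half-side [N] are
    compact, and they exhaust [X]. By Baire some [K N] contains a ball, and an affine map blows that
    ball up until its image covers [norm_ball r], a closed set. *)
Lemma finite_dimensional_compact_norm_ball (R : realType)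
    (X : completeNormedModType R) (r : R) :
  finite_dimensional X -> compact (norm_ball r : set X).
Proof.
move=> [n [e span_e]].
pose f (v : 'rV[R]_n) : X := \sum_(i < n) v ord0 i *: e i.
have f_cont : continuous f.
  apply: continuous_big => [|i _ v]; first exact: add_continuous.
  apply: (@cvgZr_tmp _ _ _ (nbhs v)).
  exact: coord_continuous.
pose K (N : nat) := f @` [set v : 'rV[R]_n |
  forall i, `[- N%:R, N%:R]%classic (v ord0 i)].
have K_compact N : compact (K N).
  apply: continuous_compact; first exact: continuous_subspaceT.
  by apply: (@rV_compact R n (fun=> `[- N%:R, N%:R]%classic)) => i;
    exact: segment_compact.
have K_cover x : exists N, K N x.
  have [a ->] := span_e x.
  exists (Num.trunc (\sum_i `|a i|)).+1; exists (\row_i a i) => [i|] /=.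
    rewrite mxE in_itv/= -ler_norml.
    apply: (@le_trans _ _ (\sum_i `|a i|)); last first.
      by rewrite ltW// truncnS_gt.
    by rewrite (bigD1 i)//= lerDl sumr_ge0.
  by rewrite /f; apply: eq_bigr => i _; rewrite mxE.
have [N nK] : exists N, ~ dense (~` K N).
  apply/not_existsP => dK.
  have /(_ (fun N => ~` K N)) := @Baire _ X.
  case/(_ _ setT).
  - move=> N; split; last exact: contrapT (dK N).
    apply: closed_openC.
    by apply: compact_closed => //; exact: norm_hausdorff.
  - by exists 0.
  - exact: openT.
  - by move=> x [_ Kx]; have [N KNx] := K_cover x; exact: (Kx N).
have [G [[a /open_nbhs_nbhs/nbhs_ballP[d /= d0 adG]] GK]] := denseNE nK.
have adK : ball a d `<=` K N.
  move=> x /adG Gx; apply: contrapT => nKx.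
  suff : (G `&` ~` K N) x by rewrite GK.
  by [].
have norm_ball_closed : closed (norm_ball r : set X).
  rewrite (_ : norm_ball r = (@Num.norm R X) @^-1` [set t : R | t <= r])//.
  apply: closed_comp; last exact: closed_le.
  by move=> x _; exact: norm_continuous.
(* [s] is positive and exceeds [r] whatever the sign of [r]; [g] carries [ball a d] onto the open
   ball of radius [s] about 0. *)
pose s := `|r| + 1.
have s0 : 0 < s by rewrite ltr_wpDl.
pose g (x : X) := (s / d) *: (x - a).
apply: (@subclosed_compact _ _ (g @` K N)) => //.
  apply: continuous_compact => //; apply: continuous_subspaceT => x.
  apply: cvgZl_tmp; apply: cvgB; [exact: cvg_id|exact: cvg_cst].
move=> x /= xr; exists (a + (d / s) *: x); last first.
  rewrite /g addrAC subrr add0r scalerA mulrA divfK ?gt_eqF//.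
  by rewrite divff ?scale1r ?gt_eqF.
apply: adK; rewrite -ball_normE/= opprD addrA subrr add0r normrN normrZ.
rewrite gtr0_norm ?divr_gt0// mulrAC ltr_pdivrMr// ltr_pM2l//.
by rewrite (le_lt_trans xr)// /s (le_lt_trans (ler_norm _))// ltrDl.
Qed.

(** Take for [u] the unit vector pointing from [c] to [y]: then [y + e *: u] is at distance
    [|y - c| + e] from [c], while a point of [ball c r] within [e] of it makes this distance less
    than [r + e]. *)
Lemma ball_mem_of_approx (R : realType) (X : normedModType R) (c y : X)
    (r e : R) :
  0 < r -> 0 < e ->
  (forall u : X, `|u| <= 1 -> ball c r `&` ball (y + e *: u) e !=set0) ->
  ball c r y.
Proof.
move=> r0 e0 approx.
have [->|yc] := eqVneq y c; first exact: ballxx.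
have yc0 : 0 < `|y - c| by rewrite normr_gt0 subr_eq0.
have [|z []] := approx (`|y - c|^-1 *: (y - c)).
  by rewrite normrZ normfV normr_id mulVf ?gt_eqF.
rewrite -!ball_normE/= => cz yz.
rewrite distrC -(ltrD2r e).
have <- : `|y + e *: (`|y - c|^-1 *: (y - c)) - c| = `|y - c| + e.
  rewrite addrAC scalerA -[X in X + _]scale1r -scalerDl normrZ gtr0_norm.
    by rewrite mulrDl mul1r divfK ?gt_eqF.
  by rewrite addr_gt0// divr_gt0.
by rewrite (le_lt_trans (ler_distD z _ _))// addrC ltrD// distrC.
Qed.

Lemma open_balls_centered_in_neq0 (R : realType) (X : normedModType R)
    (C B : set X) :
  open_balls_centered_in C B -> B !=set0 ->
  exists c r, [/\ C c, 0 < r & B = ball c r].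
Proof.
move=> [c [r [Cc r0 ->]]] [x]; rewrite -ball_normE/= => cx.
by exists c, r; split=> //; exact: le_lt_trans cx.
Qed.

Lemma lsc_on_ball_fibre_open (R : realType) (X : normedModType R)
    (C D : set X) (F : X -> set X) (x y : X) :
  compact (norm_ball 1 : set X) ->
  (forall x, D x -> open_balls_centered_in C (F x)) ->
  (forall x, D x -> F x !=set0) ->
  lsc_on D F ->
  D x -> F x y -> \forall x' \near x, D x' -> F x' y.
Proof.
move=> cptB Fball F0 lscF Dx Fxy.
have : nbhs y (F x).
  have [c [r [_ _ Fx]]] := Fball _ Dx; rewrite Fx in Fxy *.
  by apply: open_nbhs_nbhs; split=> //; exact: ball_open.
move=> /nbhs_ballP[e2 /= e20 yF].
pose e := e2 / 2; have e0 : 0 < e by rewrite divr_gt0.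
have yeF u : `|u| <= 1 -> F x (y + e *: u).
  move=> u1; apply: yF; rewrite -ball_normE/= opprD addrA subrr add0r normrN.
  by rewrite normrZ gtr0_norm// (le_lt_trans (ler_piMr (ltW e0) u1))// gtr_pMr//
    invf_lt1// ltr1n.
pose P x' u := D x' -> F x' `&` ball (y + e *: u) e !=set0.
(* Lower semicontinuity gives a neighbourhood of [x] for each [u]; compactness makes one
   neighbourhood serve all [u] in the unit ball. *)
have /compact_near_coveringP/(_ _ _ P (nbhs_filter x)) cover := cptB.
apply: filterS (cover _).
  move=> x' /= approx Dx'.
  have [c [r [_ r0 Fx']]] :=
    open_balls_centered_in_neq0 _ _ _ _ (Fball _ Dx') (F0 _ Dx').
  rewrite Fx'; apply: (@ball_mem_of_approx _ _ _ _ _ e) => // u u1.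
  by rewrite -Fx'; exact: (approx u u1 Dx').
move=> u u1.
have [||U xU FU] := lscF x Dx (ball (y + e *: u) (e / 2)).
- exact: ball_open.
- exists (y + e *: u); split; first exact: yeF.
  by apply: ballxx; rewrite divr_gt0.
(* Moving [u] by less than 1/2 shifts the target [y + e *: u] by less than [e / 2]; the other
   [e / 2] is the radius at which [F x'] is hit. *)
exists (ball u 2^-1, U) => /=.
  by split; [apply: nbhsx_ballx; rewrite invr_gt0|exact: open_nbhs_nbhs].
move=> [u' x'] /= [uu' Ux'] Dx'.
have [z [Fz uz]] := FU x' Dx' Ux'.
exists z; split=> //.
move: uu' uz; rewrite -!ball_normE/= => uu' uz.
rewrite (le_lt_trans (ler_distD (y + e *: u) _ _))// [ltRHS](splitr e) ltrD//.
have -> : y + e *: u' - (y + e *: u) = e *: (u' - u).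
  by rewrite opprD addrACA subrr add0r scalerBr.
rewrite normrZ gtr0_norm// ltr_pM2l//.
by rewrite distrC.
Qed.

(** Connectedness is applied on the segment from 0 to [x], parametrised by [t *: x] with [t] in
    [[0, 1]]. *)
Lemma fibre_clopen_constant (R : realType) (X : normedModType R)
    (F : X -> set X) (r : R) (x y : X) :
  (forall x, norm_ball r x -> F x y ->
    \forall x' \near x, norm_ball r x' -> F x' y) ->
  closed [set x | norm_ball r x /\ F x y] ->
  norm_ball r x -> F 0 y -> F x y.
Proof.
move=> Fopen Fclosed xr F0y.
pose I := `[0, 1]%classic : set R.
have Ir t : I t -> norm_ball r (t *: x).
  rewrite /I/= in_itv/= => /andP[t0 t1]; rewrite /norm_ball/= normrZ ger0_norm//.
  by rewrite (le_trans _ xr)// ler_piMl.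
have scale_cont : continuous (fun t : R => t *: x).
  by move=> t; apply: cvgZr_tmp; exact: cvg_id.
pose g t : set X := F (t *: x).
suff IE : [set t | I t /\ g t y] = I.
  have : I 1 by rewrite /I/= in_itv/= ler01 lexx.
  by rewrite -IE => -[_]; rewrite /g scale1r.
apply: (@segment_connected R 0 1).
- by exists 0; split; rewrite /I/g/= ?scale0r// in_itv/= lexx ler01.
(* The fibre is open only relative to the ball; the implication from [I t] turns this into an open
   set of reals with the right trace on [I]. *)
- exists (interior [set t | I t -> g t y]); first exact: open_interior.
  apply/seteqP; split=> t [It gt]; split=> //; last exact: (interior_subset gt It).
  have := scale_cont t _ (Fopen _ (Ir _ It) gt).
  by apply: (@filterS _ (nbhs t)) => t' /= Ft' It'; apply: Ft'; exact: Ir.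
- exists ((fun t : R => t *: x) @^-1` [set x | norm_ball r x /\ F x y]).
    by apply: closed_comp => // t _; exact: scale_cont.
  apply/seteqP; split=> t [It] => [gt|[_ gt]]; split=> //.
  by split=> //; exact: Ir.
Qed.

Lemma dist_eq0 (R : realType) (X : normedModType R) (A : set X) (y : X) :
  A y -> dist y A = 0.
Proof.
move=> Ay; apply/eqP; rewrite eq_le; apply/andP; split.
  apply: ge_inf; last by exists y; rewrite // subrr normr0.
  by exists 0 => _ [x _ <-].
apply: lb_le_inf; first by exists `|y - y|; exists y.
by move=> _ [x _ <-].
Qed.

Lemma separable_sequence (T : topologicalType) (A : set T) :
  separable_set A -> A !=set0 ->
  exists q : nat -> T, A `<=` closure (range q).
Proof.
move=> [S [/pfcard_geP[S0 _|/unsquash q _]] AS] [x Ax].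
  by have := AS _ Ax; rewrite S0 closure0.
exists q => z /AS; apply: closure_subset => {}z /(@surj _ _ _ _ q)[n _ <-].
by exists n.
Qed.

(* [q] lies in the ball [T w] iff, at some scale [e], [T w] hits the balls of
   radius [e / 2] around all points of the dense sequence near [q]. *)
Lemma measurable_ball_mem (d : measure_display) (Omega : measurableType d)
    (R : realType) (X : normedModType R) (C : set X) (T : Omega -> set X)
    (p : nat -> X) (q : X) :
  norm_ball 2 `<=` closure (range p) ->
  norm_ball 1 q ->
  (forall w, open_balls_centered_in C (T w)) ->
  (forall w, T w !=set0) ->
  (forall V, open V -> measurable [set w | T w `&` V !=set0]) ->
  measurable [set w | T w q].
Proof.
move=> p_dense q1 Tball T0 Tmeas.
pose e k : R := k.+1%:R^-1.
have e0 k : 0 < e k by rewrite invr_gt0.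
rewrite (_ : [set w | T w q] = \bigcup_k \bigcap_(m in
    [set m | ball q (2 * e k) (p m)])
    [set w | T w `&` ball (p m) (e k / 2) !=set0]).
  apply: bigcupT_measurable => k; apply: bigcap_measurableType => m _.
  by apply: Tmeas; exact: ball_open.
apply/seteqP; split=> w /=.
  move=> Tq.
  have : nbhs q (T w).
    have [c [r [_ _ Tw]]] := Tball w; rewrite Tw in Tq *.
    by apply: open_nbhs_nbhs; split=> //; exact: ball_open.
  move=> /nbhs_ballP[s /= s0 qs].
  (* This index gives [2 * e k <= s], so every [p m] concerned lies in [T w] itself. *)
  exists (Num.trunc (2 / s)) => // m /= qpm; exists (p m); split; last first.
    by apply: ballxx; rewrite divr_gt0.
  apply: qs; apply: le_ball qpm.
  rewrite /e ler_pdivrMr// mulrC -ler_pdivrMr//.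
  by rewrite ltW// truncnS_gt.
move=> [k _ approx].
have [c [r [_ r0 Tw]]] := open_balls_centered_in_neq0 _ _ _ _ (Tball w) (T0 w).
rewrite Tw; apply: (@ball_mem_of_approx _ _ _ _ _ (e k)) => // u u1.
rewrite -Tw.
have eu : `|e k *: u| <= e k.
  by rewrite normrZ gtr0_norm// ler_piMr// ltW.
(* Since [e k <= 1] and [q] has norm at most 1, the point stays in the ball of radius 2, where the
   sequence is dense. *)
have : closure (range p) (q + e k *: u).
  apply: p_dense; rewrite /norm_ball/= (le_trans (ler_normD _ _))//.
  rewrite [leRHS](_ : _ = 1 + 1)// lerD// (le_trans eu)//.
  by rewrite /e invf_le1// ler1n.
move=> /(_ (ball (q + e k *: u) (e k / 2))) []; first exact/nbhsx_ballx/divr_gt0.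
move=> _ [[m _ <-]] qpm.
have [|z [Twz pz]] := approx m.
  move: qpm; rewrite -!ball_normE/= => qpm.
  rewrite (le_lt_trans (ler_distD (q + e k *: u) _ _))//.
  rewrite mulr2n mulrDl mul1r ler_ltD//.
    by rewrite opprD addrA subrr add0r normrN.
  by rewrite (lt_le_trans qpm)// ler_piMr ?ltW// invf_lt1// ltr1n.
exists z; split=> //; rewrite [X in ball _ X](splitr (e k)).
exact: ball_triangle pz.
Qed.

(** The preimage of [V] is the countable union, over the [n] with [q n] in [V], of the events that
    [n] is the least index satisfying [E]. *)
Lemma measurable_first_hit (d d' : measure_display) (Omega : measurableType d)
    (Y : measurableType d') (q : nat -> Y) (E : Omega -> nat -> Prop) :
  (forall n, measurable [set w | E w n]) ->
  (forall w, exists n, E w n) ->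
  exists xi : Omega -> Y, measurable_fun [set: Omega] xi /\
    forall w, exists2 n, E w n & xi w = q n.
Proof.
move=> Emeas E0.
have exE w : exists n, `[< E w n >].
  by have [n En] := E0 w; exists n; exact/asboolP.
pose N w := ex_minn (exE w).
exists (q \o N); split; last first.
  by move=> w; exists (N w) => //; rewrite /N; case: ex_minnP => n /asboolP.
move=> _ V _; rewrite setTI.
rewrite (_ : _ @^-1` V = \bigcup_(n in q @^-1` V)
    ([set w | E w n] `\` \bigcup_(m in [set m | (m < n)%N]) [set w | E w m])).
  apply: bigcup_measurable => n _; apply: measurableD; first exact: Emeas.
  by apply: bigcup_measurable.
apply/seteqP; split=> w /=.
  rewrite /N; case: ex_minnP => n /asboolP En min_n Vn.
  exists n => //; split=> // -[m /= mn Em].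
  by have := min_n m (asboolT Em); rewrite leqNgt mn.
move=> [n Vn [En nEm]]; rewrite /N; case: ex_minnP => m /asboolP Em min_m.
suff -> : m = n by [].
apply/eqP; rewrite eqn_leq min_m/=; last exact/asboolP.
by rewrite leqNgt; apply/negP => mn; apply: nEm; exists m.
Qed.

Theorem corollary2 (d : measure_display) (Omega : measurableType d)
    (R : realType) (X : completeNormedModType R)
    (T : Omega -> X -> set X)
    (B1 := norm_ball 1 : set X) (B2 := norm_ball 2 : set X) :
  finite_dimensional X ->
  separable_set B2 ->
  (forall w x, B2 x -> open_balls_centered_in B1 (T w x)) ->
  random_operator_on B2 T ->
  (forall w, lsc_on B2 (T w)) ->
  (forall w, condensing_on B2 (T w)) ->
  (forall w x, B2 x -> T w x !=set0) ->
  (forall w y, closed [set x | B2 x /\ T w x y]) ->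
  exists (xi : Omega -> X) (eta : Omega -> X),
    [/\ measurable_fun [set: Omega] (xi : Omega -> borelType X),
        (forall w, B1 (xi w)),
        (forall w, T w (xi w) (eta w)) &
        forall w, `|eta w - xi w| = dist (eta w) B1 /\
          dist (eta w) B1 = dist (eta w) (closure (inward_set B1 (xi w)))].
Proof.
move=> fdX sepB2 Tball Tmeas Tlsc _ Tneq0 Tclosed.
have B20 : B2 0 by rewrite /B2/norm_ball/= normr0.
have B12 : B1 `<=` B2 by move=> x /le_trans; apply; rewrite ler1n.
have cptB := finite_dimensional_compact_norm_ball _ _ 1 fdX.
have Tconst w x y : B2 x -> T w 0 y -> T w x y.
  apply: fibre_clopen_constant => // z B2z.
  by apply: (@lsc_on_ball_fibre_open _ _ B1) => //; [exact: Tball|exact: Tneq0].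
have [q q_dense] := separable_sequence _ _ sepB2 (ex_intro _ 0 B20).
have [||xi [xi_meas xiP]] :=
  @measurable_first_hit _ _ Omega (borelType X) q
    (fun w n => B1 (q n) /\ T w 0 (q n)).
- move=> n; have [q1|q1] := pselect (B1 (q n)); last first.
    by rewrite [X in measurable X](_ : _ = set0)//; apply/seteqP; split=> // w [].
  rewrite [X in measurable X](_ : _ = [set w | T w 0 (q n)]).
    apply: (@measurable_ball_mem _ _ _ _ B1 (fun w => T w 0) q) => //.
    - by move=> w; exact: Tball.
    - by move=> w; exact: Tneq0.
    - exact: Tmeas.
  by apply/seteqP; split=> w => [[]|].
- move=> w; have [c [r [c1 r0 Tw]]] :=
    open_balls_centered_in_neq0 _ _ _ _ (Tball w _ B20) (Tneq0 w _ B20).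
  (* The centre [c] may lie on the unit sphere, where nearby terms of [q] can fall outside [B1].
     Shrinking it to [(1 - t) *: c] moves it by at most [t < r] and makes its norm less than 1, so
     density applies to an open set inside both balls. *)
  pose t := Num.min r 1 / 2.
  have m0 : 0 < Num.min r 1 by rewrite lt_min r0 ltr01.
  have t0 : 0 < t by rewrite divr_gt0.
  have tm : t < Num.min r 1 by rewrite gtr_pMr// invf_lt1// ltr1n.
  have /andP[tr t1] : (t < r) && (t < 1) by rewrite -lt_min.
  have cz : ball c r ((1 - t) *: c).
    rewrite -ball_normE/= scalerBl scale1r opprB addrC subrK normrZ gtr0_norm//.
    by rewrite (le_lt_trans _ tr)// ler_piMr// ltW.
  have z1 : ball 0 1 ((1 - t) *: c : X).
    rewrite -ball_normE/= sub0r normrN normrZ gtr0_norm ?subr_gt0//.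
    by rewrite (@le_lt_trans _ _ (1 - t)) ?ler_piMr ?gtrBl// subr_ge0 ltW.
  have /q_dense/(_ (ball c r `&` ball 0 1)) : B2 ((1 - t) *: c).
    by apply: B12; move: z1; rewrite -ball_normE/= sub0r normrN => /ltW.
  case=> [|_ [[n _ <-] [cq]]].
    by apply: filterI; apply: open_nbhs_nbhs; split=> //; exact: ball_open.
  rewrite -ball_normE/= sub0r normrN => /ltW q1.
  by exists n; split=> //; rewrite Tw.
exists xi, xi; split=> //.
- by move=> w; have [n [q1 _] ->] := xiP w.
- by move=> w; have [n [q1 Tq] ->] := xiP w; apply: Tconst => //; exact: B12.
move=> w; have [n [q1 _] ->] := xiP w.
rewrite subrr normr0 !dist_eq0//; apply: subset_closure.
(* Parameter 0 puts the point in its own inward set. *)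
by exists (q n), 0; rewrite scale0r addr0.
Qed.
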